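(* Let $1\le k\le n$ and let $K:\mathbb{B}^n\times\mathbb{B}^n\to\mathbb{R}$ be a reproducing kernel. For any $R\in SO(n)$, the $k$-plane transform $\mathcal{K}_R:\mathbb{H}(K)\to\mathbb{H}(\tilde K^R)$ is a contractive, surjective, linear map. Its adjoint operator $\mathcal{K}_R^*:\mathbb{H}(\tilde K^R)\to\mathbb{H}(K)$ is an isometry, uniquely determined by $$\mathcal{K}_R^*(\tilde k^R_{\mathbf{x}})=\int_{W(\mathbf{x})\cdot\mathbb{B}^k}k_{R^\top[\mathbf{x}:z]}\,dz,\qquad\mathbf{x}\in\mathbb{B}^{n-k},$$ in the sense of Bochner integration. Let $\mathbb{H}_R(K):=\mathcal{R}(\mathcal{K}_R^* )$ be the range of $\mathcal{K}_R^*$ and $\mathcal{N}(\mathcal{K}_R)$ the null space of $\mathcal{K}_R$. Then: (1) $\mathcal{K}_R\circ\mathcal{K}_R^*:\mathbb{H}(\tilde K^R)\to\mathbb{H}(\tilde K^R)$ is the identity. (2) $\mathbb{H}_R(K)=(\mathcal{N}(\mathcal{K}_R))^\perp$ and $(\mathbb{H}_R(K))^\perp=\mathcal{N}(\mathcal{K}_R)$. (3) Any $f\in\mathbb{H}(K)$ can be uniquely expressed as a direct sum $f=(\mathcal{K}_R^*\circ\mathcal{K}_R)f\oplus(f-(\mathcal{K}_R^*\circ\mathcal{K}_R)f)\in\mathbb{H}_R(K)\oplus\mathcal{N}(\mathcal{K}_R)$; thus $f\in\mathbb{H}_R(K)$ if and only if $f=(\mathcal{K}_R^*\circ\mathcal{K}_R)f$.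 (4) For $g\in\mathbb{H}(\tilde K^R)$, we have $$\{f\in\mathbb{H}(K):g=\mathcal{K}_Rf\}=\mathcal{K}_R^*g\oplus\mathcal{N}(\mathcal{K}_R),\qquad\|g\|_{\mathbb{H}(\tilde K^R)}=\|\mathcal{K}_R^*g\|_{\mathbb{H}(K)}=\min\{\|f\|_{\mathbb{H}(K)}:g=\mathcal{K}_Rf\}.$$
   Context: Throughout $n\ge2$. $\mathbb{B}^m$ is the closed unit ball of $\mathbb{R}^m$; $[\mathbf{x}:z]\in\mathbb{R}^n$ denotes the concatenation of $\mathbf{x}\in\mathbb{R}^{n-k}$ and $z\in\mathbb{R}^k$; $W(\mathbf{x}):=\sqrt{1-\|\mathbf{x}\|^2}$, and $W(\mathbf{x})\cdot\mathbb{B}^k$ is the closed ball of radius $W(\mathbf{x})$ in $\mathbb{R}^k$. A (reproducing) kernel on a set $E$ is a real symmetric positive semidefinite function on $E\times E$; $\mathbb{H}(K)$ is its RKHS of real functions, $k_{\mathbf{z}}:=K(\cdot,\mathbf{z})$. The $k$-plane transform at orientation $R\in SO(n)$ is $\mathcal{K}_Rf(\mathbf{x})=\int_{W(\mathbf{x})\cdot\mathbb{B}^k}f(R^\top[\mathbf{x}:z])\,dz$, $\mathbf{x}\in\mathbb{B}^{n-k}$. The induced kernel $\tilde K^R:\mathbb{B}^{n-k}\times\mathbb{B}^{n-k}\to\mathbb{R}$ is $$\tilde K^R(\mathbf{x}_1,\mathbf{x}_2):=\int_{W(\mathbf{x}_2)\cdot\mathbb{B}^k}\int_{W(\mathbf{x}_1)\cdot\mathbb{B}^k}K(R^\top[\mathbf{x}_1:z_1],R^\top[\mathbf{x}_2:z_2])\,dz_1\,dz_2,$$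 with generators $\tilde k^R_{\mathbf{x}}:=\tilde K^R(\cdot,\mathbf{x})$. These integrals are assumed to exist for all arguments (automatic when $K$ is continuous).
   Formalization: The Bochner integrals of z -> k_{R^T[x:z]} are assumed to exist for every x; the existence of the integrals defining K_R f and the induced kernel does not imply this (K(x,y) = 1 if x = y, else 0, is a counterexample). *)

(* Defs.v *)
From HB Require Import structures.
From mathcomp Require Import all_boot all_order all_algebra.
From mathcomp Require Import all_classical all_reals all_analysis.

Set Implicit Arguments.
Unset Strict Implicit.
Unset Printing Implicit Defensive.

Import Order.TTheory GRing.Theory Num.Theory.
Import numFieldNormedType.Exports.

Local Open Scope classical_set_scope.
Local Open Scope ring_scope.

Section lebesgue_cV.
Context {R : realType} {k : nat}.

(* [Some (a, b)] is the closed box prod_i [a_i, b_i]; [None] is the empty set,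
   needed because a box in R^0 is never empty. *)
Definition box (c : option ('cV[R]_k * 'cV[R]_k)) : set 'cV[R]_k :=
  if c is Some ab then [set v | forall i, ab.1 i 0 <= v i 0 <= ab.2 i 0]
  else set0.

Definition box_volume (c : option ('cV[R]_k * 'cV[R]_k)) : R :=
  if c is Some ab then \prod_i Num.max 0 (ab.2 i 0 - ab.1 i 0) else 0.

Lemma box_volume_ge0 c : 0 <= box_volume c.
Proof.
case: c => [ab|] //=; apply: prodr_ge0 => i _; by rewrite le_max lexx.
Qed.

Definition lebesgue_outer (A : set 'cV[R]_k) : \bar R :=
  ereal_inf [set (\sum_(j <oo) (box_volume (c j))%:E)%E |
    c in [set c : nat -> option ('cV[R]_k * 'cV[R]_k) |
          A `<=` \bigcup_j box (c j)]].

Local Open Scope ereal_scope.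

Let vol_ge0 (c : nat -> option ('cV[R]_k * 'cV[R]_k)) j :
  0 <= (box_volume (c j))%:E.
Proof. by rewrite lee_fin box_volume_ge0. Qed.

Lemma lebesgue_outer_ge0 A : 0 <= lebesgue_outer A.
Proof.
by apply: le_ereal_inf_tmp => _ [c _ <-]; apply: nneseries_ge0 => j _ _.
Qed.

Lemma lebesgue_outer0 : lebesgue_outer set0 = 0.
Proof.
apply/eqP; rewrite eq_le lebesgue_outer_ge0 andbT.
apply: ereal_inf_lbound; exists (fun=> None) => //=.
by rewrite eseries0.
Qed.

Lemma le_lebesgue_outer : {homo lebesgue_outer : A B / A `<=` B >-> A <= B}.
Proof.
move=> A B AB; apply/ereal_inf_le_tmp => _ [c Bc <-].
by exists c => //; exact: subset_trans AB Bc.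
Qed.

Lemma lebesgue_outer_sigma_subadditive : sigma_subadditive lebesgue_outer.
Proof.
move=> A; have [[i ioo]|] := pselect (exists i, lebesgue_outer (A i) = +oo).
  rewrite (eseries_pinfty _ _ ioo) ?leey// => n _.
  by rewrite -ltNye (lt_le_trans _ (lebesgue_outer_ge0 _)).
rewrite -forallNE => Aoo.
apply/lee_addgt0Pr => _/posnumP[e].
rewrite (le_trans _ (epsilon_trick _ _ _))//; last first.
  by move=> n; exact: lebesgue_outer_ge0.
pose P n (c : nat -> option ('cV[R]_k * 'cV[R]_k)) :=
  A n `<=` \bigcup_j box (c j) /\
  \sum_(j <oo) (box_volume (c j))%:E
    <= lebesgue_outer (A n) + (e%:num / (2 ^ n.+1)%:R)%:E.
have [G PG] : {G : nat -> nat -> option ('cV[R]_k * 'cV[R]_k) &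
               forall n, P n (G n)}.
  apply: (@choice _ _ P) => n; rewrite /P.
  have fA : lebesgue_outer (A n) \is a fin_num.
    rewrite ge0_fin_numE ?lebesgue_outer_ge0// lt_neqAle leey andbT.
    by apply/eqP; exact: Aoo.
  have en1 : (0 < e%:num / (2 ^ n.+1)%:R)%R by [].
  have [_ [c Ac <-] cl] := lb_ereal_inf_adherent en1 fA.
  by exists c; split => //; exact/ltW.
pose v (p : nat * nat) := (box_volume (G p.1 p.2))%:E.
have v_ge0 p : 0 <= v p by rewrite lee_fin box_volume_ge0.
apply: (@le_trans _ _ (\esum_(p in setT) v p)).
  apply: ereal_inf_lbound => /=.
  have /card_esym/ppcard_eqP[f] := card_nat2.
  exists (fun j => G (f j).1 (f j).2).
    move=> t [i _] /(PG i).1 [j _ Gijt].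
    by exists (f^-1%FUN (i, j)) => //=; rewrite invK ?inE.
  rewrite nneseries_esumT; last by move=> j; rewrite lee_fin box_volume_ge0.
  by rewrite (reindex_esum setT setT f).
rewrite (_ : esum _ _ = \sum_(i <oo) \sum_(j <oo) (box_volume (G i j))%:E).
  apply: lee_nneseries => [i _ _|i _]; last exact: (PG i).2.
  by apply: nneseries_ge0 => j _ _; rewrite lee_fin box_volume_ge0.
rewrite nneseries_esumT; last first.
  by move=> i; apply: nneseries_ge0 => j _ _; rewrite lee_fin box_volume_ge0.
rewrite (eq_esum (fun i _ => nneseries_esumT (fun j => v_ge0 (i, j)))).
rewrite (@esum_esum _ _ _ setT (fun=> setT) (fun i j => v (i, j))) //.
by rewrite (_ : _ `*`` _ = setT) ?predeqE //; apply: eq_esum => -[].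
Qed.

HB.instance Definition _ := isOuterMeasure.Build R 'cV[R]_k lebesgue_outer
  lebesgue_outer0 lebesgue_outer_ge0 le_lebesgue_outer
  lebesgue_outer_sigma_subadditive.

End lebesgue_cV.

Definition lebesgue_om (R : realType) (k : nat) :
  {outer_measure set 'cV[R]_k -> \bar R} := @lebesgue_outer R k.

(* R^k with the sigma-algebra of all Lebesgue (= Caratheodory) measurable
   sets. *)
Definition Leb (R : realType) (k : nat) := caratheodory_type (lebesgue_om R k).

Definition lebesgue (R : realType) (k : nat) :
    {measure set (Leb R k) -> \bar R} :=
  (lebesgue_om R k : set (caratheodory_type (lebesgue_om R k)) -> \bar R).

Lemma lebesgueE (R : realType) (k : nat) (A : set 'cV[R]_k) :
  lebesgue R k A = lebesgue_outer A.
Proof. by []. Qed.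

Lemma lebesgue_complete (R : realType) (k : nat) :
  measure_is_complete (lebesgue R k).
Proof. exact: measure_is_complete_caratheodory. Qed.

Section function_spaces.
Context {R : realType}.

(* A real Hilbert space whose elements are functions on [E].  The inner product
   is a total function; only its values on members of the space matter. *)
Record hilbert_fun (E : Type) := HilbertFun {
  hmem :> (E -> R) -> Prop;
  ip : (E -> R) -> (E -> R) -> R;
  hmem0 : hmem (fun=> 0);
  hmem_lin : forall a f g, hmem f -> hmem g ->
    hmem (fun x => a * f x + g x);
  ip_sym : forall f g, hmem f -> hmem g -> ip f g = ip g f;
  ip_linl : forall a f g h, hmem f -> hmem g -> hmem h ->
    ip (fun x => a * f x + g x) h = a * ip f h + ip g h;
  ip_ge0 : forall f, hmem f -> 0 <= ip f f;
  ip_def : forall f, hmem f -> ip f f = 0 -> f = (fun=> 0);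
  hcomplete : forall u : nat -> E -> R, (forall j, hmem (u j)) ->
    (forall e, 0 < e -> exists N, forall i j, (N <= i)%N -> (N <= j)%N ->
       ip (u i \- u j) (u i \- u j) < e ^+ 2) ->
    exists2 f, hmem f &
      (fun j => Num.sqrt (ip (u j \- f) (u j \- f))) @ \oo --> 0 }.

Definition hnorm (E : Type) (H : hilbert_fun E) (f : E -> R) : R :=
  Num.sqrt (ip H f f).

Definition reproducing_kernel (E : Type) (K : E -> E -> R) : Prop :=
  (forall x y, K x y = K y x) /\
  (forall N (x : 'I_N -> E) (c : 'I_N -> R),
     0 <= \sum_i \sum_j c i * c j * K (x i) (x j)).

Definition generator (E : Type) (K : E -> E -> R) (z : E) : E -> R :=
  fun y => K y z.

(* By the Moore-Aronszajn theorem every reproducing kernel has exactly one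
   RKHS, so a statement about every [H] with [is_rkhs K H] is a statement about
   H(K). *)
Definition is_rkhs (E : Type) (K : E -> E -> R) (H : hilbert_fun E) : Prop :=
  (forall z, H (generator K z)) /\
  (forall f z, H f -> ip H f (generator K z) = f z).

Definition orthocompl (E : Type) (H : hilbert_fun E) (S : set (E -> R)) :
  set (E -> R) := [set f | H f /\ forall g, S g -> ip H f g = 0].

Section operators.
Context {E1 E2 : Type} (H1 : hilbert_fun E1) (H2 : hilbert_fun E2).
Implicit Type T : (E1 -> R) -> (E2 -> R).

Definition linear_op T : Prop :=
  (forall f, H1 f -> H2 (T f)) /\
  (forall a f g, H1 f -> H1 g ->
     T (fun x => a * f x + g x) = (fun y => a * T f y + T g y)).

Definition bounded_op T : Prop :=
  exists C, forall f, H1 f -> hnorm H2 (T f) <= C * hnorm H1 f.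

Definition contractive_op T : Prop :=
  forall f, H1 f -> hnorm H2 (T f) <= hnorm H1 f.

Definition surjective_op T : Prop :=
  forall g, H2 g -> exists2 f, H1 f & T f = g.

Definition isometric_op T : Prop :=
  forall f, H1 f -> hnorm H2 (T f) = hnorm H1 f.

Definition null_space T : set (E1 -> R) := [set f | H1 f /\ T f = (fun=> 0)].

Definition op_range T : set (E2 -> R) := [set T f | f in hmem H1].

Definition is_adjoint T (A : (E2 -> R) -> (E1 -> R)) : Prop :=
  (forall g, H2 g -> H1 (A g)) /\
  (forall f g, H1 f -> H2 g -> ip H2 (T f) g = ip H1 f (A g)).

End operators.

Section bochner.
Context d (T : measurableType d) (mu : {measure set T -> \bar R}).
Context (E : Type) (H : hilbert_fun E).

(* The list [s] of pairs (A, h) encodes the simple function sum 1_A h. *)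
Definition simple_map := seq (set T * (E -> R)).

Definition is_simple (s : simple_map) : Prop :=
  forall i, (i < size s)%N ->
    let p := nth (set0, fun=> 0) s i in
    [/\ measurable p.1, (mu p.1 < +oo)%E & H p.2].

Definition simple_eval (s : simple_map) (z : T) : E -> R :=
  fun y => \sum_(p <- s) \1_(p.1) z * p.2 y.

Definition simple_integral (D : set T) (s : simple_map) : E -> R :=
  fun y => \sum_(p <- s) fine (mu (p.1 `&` D)) * p.2 y.

(* The almost-everywhere clause is strong measurability of [F].  For a complete
   measure it makes the scalar integrands below measurable; on non-measurable
   functions [\int] would only be a lower integral. *)
Definition is_bochner_integral (D : set T) (F : T -> E -> R) (m : E -> R) :
    Prop :=
  [/\ (forall z, D z -> H (F z)), H m &
   exists s : nat -> simple_map,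
   [/\ forall j, is_simple (s j),
       {ae mu, forall z, D z ->
          (fun j => hnorm H (F z \- simple_eval (s j) z)) @ \oo --> 0},
       (fun j => \int[mu]_(z in D)
          (hnorm H (F z \- simple_eval (s j) z))%:E)%E @ \oo --> 0%E &
       (fun j => hnorm H (simple_integral D (s j) \- m)) @ \oo --> 0]].

End bochner.

Definition enorm m (v : 'cV[R]_m) : R := Num.sqrt (\sum_i v i 0 ^+ 2).

Definition cball m (r : R) : set 'cV[R]_m := [set v | enorm v <= r].

Definition uball m : set 'cV[R]_m := cball 1.
Arguments uball : clear implicits.

Definition SO n : set 'M[R]_n := [set Q | Q *m Q^T = 1%:M /\ \det Q = 1].
Arguments SO : clear implicits.

Lemma uball_0 m : (0 : 'cV[R]_m) \in uball m.
Proof.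
rewrite inE /uball /cball /= /enorm big1 ?sqrtr0 ?ler01 // => i _.
by rewrite mxE expr0n.
Qed.

Definition ball_center m : uball m := exist _ 0 (uball_0 m).

Section plane.
Context {n k : nat} (hkn : (k <= n)%N).

Definition concat (x : 'cV[R]_(n - k)) (z : 'cV[R]_k) : 'cV[R]_n :=
  castmx (subnK hkn, erefl) (col_mx x z).

Definition W (x : uball (n - k)) : R := Num.sqrt (1 - enorm (val x) ^+ 2).

(* The point Q^T [x : z] of the unit ball.  The default value of [insubd] is
   irrelevant for z in the ball of radius W(x), see [plane_pointE]. *)
Definition plane_point (Q : 'M[R]_n) (x : uball (n - k)) (z : 'cV[R]_k) :
  uball n := insubd (ball_center n) (Q^T *m concat (val x) z).

Definition plane_transform (Q : 'M[R]_n) (f : uball n -> R) :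
    uball (n - k) -> R :=
  fun x => \int[lebesgue R k]_(z in cball (W x)) f (plane_point Q x z).

Definition induced_kernel (Q : 'M[R]_n) (K : uball n -> uball n -> R) :
    uball (n - k) -> uball (n - k) -> R :=
  fun x1 x2 => \int[lebesgue R k]_(z2 in cball (W x2))
    \int[lebesgue R k]_(z1 in cball (W x1))
      K (plane_point Q x1 z1) (plane_point Q x2 z2).

Definition is_generator_integral (Q : 'M[R]_n) (K : uball n -> uball n -> R)
    (H : hilbert_fun (uball n)) (x : uball (n - k)) (m : uball n -> R) : Prop :=
  is_bochner_integral (lebesgue R k) H (cball (W x))
    (fun z => generator K (plane_point Q x z)) m.

Record plane_integrals_exist (Q : 'M[R]_n) (K : uball n -> uball n -> R)
    (H : hilbert_fun (uball n)) : Prop := PlaneIntegralsExist {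
  transform_integrable : forall f x, H f ->
    (lebesgue R k).-integrable (cball (W x))
      (fun z => (f (plane_point Q x z))%:E);
  kernel_integrable_in : forall x1 x2 z2, cball (W x2) z2 ->
    (lebesgue R k).-integrable (cball (W x1))
      (fun z1 => (K (plane_point Q x1 z1) (plane_point Q x2 z2))%:E);
  kernel_integrable_out : forall x1 x2,
    (lebesgue R k).-integrable (cball (W x2))
      (fun z2 => (\int[lebesgue R k]_(z1 in cball (W x1))
         K (plane_point Q x1 z1) (plane_point Q x2 z2))%:E);
  generator_integrable : forall x, exists m,
    is_generator_integral Q K H x m }.

Lemma enorm_ge0 m (v : 'cV[R]_m) : 0 <= enorm v.
Proof. exact: sqrtr_ge0. Qed.

Lemma sqr_enorm m (v : 'cV[R]_m) : enorm v ^+ 2 = (v^T *m v) 0 0.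
Proof.
rewrite sqr_sqrtr ?sumr_ge0 // => [|i _]; last exact: sqr_ge0.
by rewrite mxE; apply: eq_bigr => i _; rewrite mxE expr2.
Qed.

Lemma enorm_castmx m m' (e : m = m') (v : 'cV[R]_m) :
  enorm (castmx (e, erefl) v) = enorm v.
Proof. by case: m' / e. Qed.

Lemma sqr_enorm_concat x z :
  enorm (concat x z) ^+ 2 = enorm x ^+ 2 + enorm z ^+ 2.
Proof.
by rewrite /concat enorm_castmx !sqr_enorm tr_col_mx mul_row_col mxE.
Qed.

Lemma plane_pointE Q (x : uball (n - k)) z : SO n Q -> cball (W x) z ->
  val (plane_point Q x z) = Q^T *m concat (val x) z.
Proof.
move=> [QQ _] zW; rewrite insubdK // unfold_in /= inE /uball /cball /=.
rewrite -(@ler_pXn2r _ 2) ?nnegrE ?enorm_ge0 ?ler01 // expr1n.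
have -> : enorm (Q^T *m concat (val x) z) ^+ 2 = enorm (concat (val x) z) ^+ 2.
  by rewrite !sqr_enorm trmx_mul trmxK mulmxA -(mulmxA _ Q) QQ mulmx1.
rewrite sqr_enorm_concat -lerBrDl.
have x1 : 0 <= 1 - enorm (val x) ^+ 2.
  have := valP x; rewrite inE /uball /cball /= => x1.
  by rewrite subr_ge0 expr_le1 // enorm_ge0.
rewrite -[leRHS](sqr_sqrtr x1) ler_pXn2r ?nnegrE ?enorm_ge0 ?sqrtr_ge0 //.
Qed.

End plane.

End function_spaces.

Arguments hilbert_fun : clear implicits.
Arguments uball : clear implicits.
Arguments SO : clear implicits.
Arguments ball_center : clear implicits.

Definition is_min (R : realType) (S : set R) (v : R) : Prop :=
  S v /\ lbound S v.

(* Main.v *)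
Require Import Defs.
From HB Require Import structures.
From mathcomp Require Import all_boot all_order all_algebra.
From mathcomp Require Import all_classical all_reals all_analysis.
From mathcomp Require Import measurable_realfun ring lra.

Set Implicit Arguments.
Unset Strict Implicit.
Unset Printing Implicit Defensive.

Import Order.TTheory GRing.Theory Num.Theory.
Import numFieldNormedType.Exports.

Local Open Scope classical_set_scope.
Local Open Scope ring_scope.

(** For x in the ball of R^(n-k), let m_x be the Bochner integral of the
    generators of K over the k-plane piece above x.  Bounded functionals commute
    with the Bochner integral, so the reproducing property gives
    <f, m_x> = (KQ f)(x) for every f in H ([generator_integralE]): the plane
    transform is the analysis operator of the family m.  Applying this twice,
    the induced kernel is the Gram kernel <m_x, m_y>
    ([induced_kernel_gram]), hence positive semidefinite.

    Everything else is Hilbert space geometry of such a family.  The families m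
    in H and Kt(., x) in Ht have the same Gram matrix, and
    [gram_transfer] moves a vector from one side to the other: project it on the
    closed span of its family, approximate the projection by finite
    combinations, copy the coefficients to the other family; equality of the
    Gram matrices makes the copies Cauchy.  From H to Ht this shows
    that KQ f lies in Ht with norm at most that of f.  From Ht to H it
    produces, for each g, a preimage of the same norm that is orthogonal to the
    null space of KQ.  Such a preimage is unique, and the map A sending g to it
    is the adjoint: it is linear by uniqueness, isometric, a right inverse of KQ,
    and f - A (KQ f) lies in the null space, from which the orthogonal
    decomposition, the description of the fibres and the minimal norm property
    follow.  Uniqueness of A among bounded operators with the prescribed values
    on generators holds because generators span a dense subspace of an
    RKHS ([rkhs_dense]).

    The measure-theoretic input is the identity between <f, m_x> and
    the scalar integral ([bochner_integral_ip]), which needs the domain of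
    integration to be measurable.  For a ball and the Caratheodory
    sigma-algebra of the outer measure defined by box coverings, this comes from
    half-spaces, which cut every box into two boxes whose volumes add up. *)

(** * Inner products in Hilbert function spaces *)

Section hilbert_algebra.
Context {R : realType} {E : Type} (H : hilbert_fun R E).
Implicit Types (f g h : E -> R) (a : R).

Lemma hmemB f g : H f -> H g -> H (f \- g).
Proof.
move=> Hf Hg; have := hmem_lin (-1) Hg Hf.
by congr (hmem H _); apply/funext => x /=; rewrite mulN1r addrC.
Qed.

Lemma hmemD f g : H f -> H g -> H (f \+ g).
Proof.
move=> Hf Hg; have := hmem_lin 1 Hf Hg.
by congr (hmem H _); apply/funext => x /=; rewrite mul1r.
Qed.

Lemma hmemZ a f : H f -> H (fun x => a * f x).
Proof.
move=> Hf; have := hmem_lin a Hf (hmem0 H).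
by congr (hmem H _); apply/funext => x /=; rewrite addr0.
Qed.

Lemma ip0l h : H h -> ip H (fun=> 0) h = 0.
Proof.
move=> Hh; have := ip_linl 1 (hmem0 H) (hmem0 H) Hh.
rewrite (_ : (fun x => 1 * 0 + 0) = fun=> 0 :> R); last first.
  by apply/funext => x; rewrite mulr0 addr0.
by rewrite mul1r => /eqP; rewrite -subr_eq subrr => /eqP <-.
Qed.

Lemma ip0r h : H h -> ip H h (fun=> 0) = 0.
Proof. by move=> Hh; rewrite ip_sym ?ip0l //; exact: hmem0. Qed.

Lemma ipZl a f h : H f -> H h -> ip H (fun x => a * f x) h = a * ip H f h.
Proof.
move=> Hf Hh; rewrite -[RHS]addr0 -(ip0l Hh) -ip_linl //; last exact: hmem0.
by congr ip; apply/funext => x; rewrite addr0.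
Qed.

Lemma ipDl f g h : H f -> H g -> H h -> ip H (f \+ g) h = ip H f h + ip H g h.
Proof.
move=> Hf Hg Hh; rewrite -[ip H f h]mul1r -ip_linl //.
by congr ip; apply/funext => x /=; rewrite mul1r.
Qed.

Lemma ipBl f g h : H f -> H g -> H h -> ip H (f \- g) h = ip H f h - ip H g h.
Proof.
move=> Hf Hg Hh; rewrite addrC -mulN1r -ip_linl //.
by congr ip; apply/funext => x /=; rewrite mulN1r addrC.
Qed.

Lemma ipBr f g h : H f -> H g -> H h -> ip H h (f \- g) = ip H h f - ip H h g.
Proof.
move=> Hf Hg Hh; have Hfg := hmemB Hf Hg.
by rewrite ip_sym // ipBl // (ip_sym Hf Hh) (ip_sym Hg Hh).
Qed.

Lemma ip_sqrB f g : H f -> H g ->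
  ip H (f \- g) (f \- g) = ip H f f - 2 * ip H f g + ip H g g.
Proof.
move=> Hf Hg; have Hfg := hmemB Hf Hg.
rewrite ipBl // !ipBr // (ip_sym Hg Hf); ring.
Qed.

Lemma ip_sqrD f g : H f -> H g ->
  ip H (f \+ g) (f \+ g) = ip H f f + 2 * ip H f g + ip H g g.
Proof.
move=> Hf Hg; have Hfg := hmemD Hf Hg.
rewrite ipDl // (ip_sym Hf) // (ip_sym Hg) // !ipDl // (ip_sym Hg Hf); ring.
Qed.

Lemma hnorm_ge0 f : 0 <= hnorm H f.
Proof. exact: sqrtr_ge0. Qed.

Lemma sqr_hnorm f : H f -> hnorm H f ^+ 2 = ip H f f.
Proof. by move=> Hf; rewrite sqr_sqrtr // ip_ge0. Qed.

Lemma ip_sub_eq0 f g : H f -> H g -> ip H (f \- g) (f \- g) = 0 -> f = g.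
Proof.
move=> Hf Hg /(ip_def (hmemB Hf Hg)) e; apply/funext => x.
by have /eqP := congr1 (@^~ x) e; rewrite subr_eq0 => /eqP.
Qed.

(** Expand the square norm of <g,g> f - <f,g> g and divide by <g,g>. *)
Lemma cauchy_schwarz f g : H f -> H g ->
  ip H f g ^+ 2 <= ip H f f * ip H g g.
Proof.
move=> Hf Hg; have := ip_ge0 Hg; rewrite le_eqVlt => /orP[/eqP g0|g0].
  by rewrite -g0 (ip_def Hg (esym g0)) ip0r // mulr0 expr0n.
have Hgf := hmemZ (ip H g g) Hf; have Hfg := hmemZ (ip H f g) Hg.
have := ip_ge0 (hmemB Hgf Hfg).
rewrite ip_sqrB // !ipZl // (ip_sym Hf Hgf) (ip_sym Hf Hfg) (ip_sym Hg Hfg).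
rewrite !ipZl // (ip_sym Hg Hf) => le0.
by rewrite -subr_ge0 -(pmulr_rge0 _ g0); move: le0; congr (0 <= _); ring.
Qed.

Lemma normr_ip_le f g : H f -> H g -> `|ip H f g| <= hnorm H f * hnorm H g.
Proof.
move=> Hf Hg; rewrite -(@ler_pXn2r _ 2) ?nnegrE ?mulr_ge0 ?hnorm_ge0 //.
by rewrite real_normK ?num_real // exprMn !sqr_hnorm // cauchy_schwarz.
Qed.

Lemma hmem_sum I (r : seq I) (c : I -> R) (v : I -> E -> R) :
  (forall i, H (v i)) -> H (fun y => \sum_(i <- r) c i * v i y).
Proof.
move=> Hv; elim: r => [|i r IH].
  have := hmem0 H; congr (hmem H _).
  by apply/funext => y; rewrite big_nil.
have := hmem_lin (c i) (Hv i) IH; congr (hmem H _).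
by apply/funext => y; rewrite big_cons.
Qed.

Lemma ip_suml I (r : seq I) (c : I -> R) (v : I -> E -> R) h :
  (forall i, H (v i)) -> H h ->
  ip H (fun y => \sum_(i <- r) c i * v i y) h = \sum_(i <- r) c i * ip H (v i) h.
Proof.
move=> Hv Hh; elim: r => [|i r IH].
  rewrite big_nil -[RHS](ip0l Hh); congr ip.
  by apply/funext => y; rewrite big_nil.
rewrite big_cons -IH -ip_linl //; last exact: hmem_sum.
by congr ip; apply/funext => y; rewrite big_cons.
Qed.

End hilbert_algebra.

(** * Convergence and orthogonal projection *)

Definition hcvg (R : realType) (E : Type) (H : hilbert_fun R E)
    (u : nat -> E -> R) (f : E -> R) : Prop :=
  (fun j => hnorm H (u j \- f)) @ \oo --> (0 : R).


Section hilbert_limits.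
Context {R : realType} {E : Type} (H : hilbert_fun R E).
Implicit Types (f g h : E -> R) (u : nat -> E -> R).

Lemma hcvg_ip u f h : (forall j, H (u j)) -> H f -> H h -> hcvg H u f ->
  (fun j => ip H (u j) h) @ \oo --> ip H f h.
Proof.
move=> Hu Hf Hh uf; apply/subr_cvg0/norm_cvg0P.
apply: (@squeeze_cvgr _ _ _ _ (fun=> 0)
  (fun j => hnorm H (u j \- f) * hnorm H h)).
- near=> j; rewrite normr_ge0 /= -ipBl //; apply: normr_ip_le => //.
  exact: hmemB.
- exact: cvg_cst.
- by rewrite -[X in _ --> X](mul0r (hnorm H h)); apply: cvgMr_tmp.
Unshelve. all: by end_near. Qed.

Lemma hcvg_sqr u f : (forall j, H (u j)) -> H f -> hcvg H u f ->
  (fun j => ip H (u j) (u j)) @ \oo --> ip H f f.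
Proof.
move=> Hu Hf uf.
have -> : (fun j => ip H (u j) (u j)) =
    (fun j => hnorm H (u j \- f) ^+ 2 + (2 * ip H (u j) f - ip H f f)).
  apply/funext => j; rewrite sqr_hnorm ?ip_sqrB //; [ring|exact: hmemB].
rewrite [X in _ --> X](_ : _ = 0 * 0 + (2 * ip H f f - ip H f f)); last by ring.
apply: cvgD; first by under eq_fun do rewrite expr2; apply: cvgM; exact: uf.
by apply: cvgB; [apply: cvgMl_tmp; exact: hcvg_ip|exact: cvg_cst].
Qed.

Lemma hcvg_unique u f g : (forall j, H (u j)) -> H f -> H g ->
  hcvg H u f -> hcvg H u g -> f = g.
Proof.
move=> Hu Hf Hg uf ug; have Hfg := hmemB Hf Hg.
apply: (ip_sub_eq0 Hf Hg); rewrite ipBl //; apply/eqP; rewrite subr_eq0; apply/eqP.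
exact: (cvg_unique (@Rhausdorff R) (hcvg_ip Hu Hf Hfg uf)
  (hcvg_ip Hu Hg Hfg ug)).
Qed.

(** The completeness axiom of [hilbert_fun], with the bound on squared
    distances freed from its square. *)
Lemma hcomplete_hcvg u : (forall j, H (u j)) ->
  (forall e : R, 0 < e -> exists N, forall i j, (N <= i)%N -> (N <= j)%N ->
     ip H (u i \- u j) (u i \- u j) < e) ->
  exists2 f, H f & hcvg H u f.
Proof.
move=> Hu cu; apply: (hcomplete Hu) => e e0; apply: cu.
by rewrite exprn_gt0.
Qed.

Lemma hcvg_cauchy u f : (forall j, H (u j)) -> H f -> hcvg H u f ->
  forall e : R, 0 < e -> exists N, forall i j, (N <= i)%N -> (N <= j)%N ->
     ip H (u i \- u j) (u i \- u j) < e.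
Proof.
move=> Hu Hf uf e e0.
have e4 : 0 < e / 4 by rewrite divr_gt0.
have sqrtuf : (fun j => ip H (u j \- f) (u j \- f)) @ \oo --> (0 : R).
  have -> : (fun j => ip H (u j \- f) (u j \- f)) =
            (fun j => hnorm H (u j \- f) * hnorm H (u j \- f)).
    by apply/funext => j; rewrite -expr2 sqr_hnorm //; exact: hmemB.
  by rewrite -[X in _ --> X](mul0r 0); apply: cvgM; exact: uf.
have /cvgrPdist_lt/(_ _ e4)[N _ NP] := sqrtuf.
exists N => i j Ni Nj.
have near_f l : (N <= l)%N -> ip H (u l \- f) (u l \- f) < e / 4.
  move=> /NP; rewrite /= sub0r normrN ger0_norm //.
  exact/ip_ge0/hmemB.
have Hi := hmemB (Hu i) Hf; have Hj := hmemB (Hu j) Hf.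
have -> : u i \- u j = (u i \- f) \- (u j \- f).
  by apply/funext => x /=; rewrite opprB addrA subrK.
have := near_f _ Ni; have := near_f _ Nj; have := ip_ge0 (hmemD Hi Hj).
by rewrite (ip_sqrD Hi Hj) (ip_sqrB Hi Hj); lra.
Qed.

(** Projection on the closure of a subspace S, the limit f0 being kept together
    with a sequence in S approaching it.  Along a minimizing sequence u of the
    distance from f to S, the differences f - u_j are almost orthogonal to S:
    moving u_j in a direction g of S cannot beat the infimum, which bounds
    <f - u_j, g>^2 by <g, g> times the excess of the squared distance at u_j over
    its infimum.  This one
    estimate gives both the Cauchy property, with g = u_i - u_j, and the
    orthogonality of the limit. *)
Lemma projection_exists (S : (E -> R) -> Prop) f :
  (forall g, S g -> H g) -> S (fun=> 0) ->
  (forall a g h, S g -> S h -> S (fun x => a * g x + h x)) -> H f ->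
  exists u f0, [/\ forall j, S (u j), H f0, hcvg H u f0 &
    forall g, S g -> ip H (f \- f0) g = 0].
Proof.
move=> SH S0 Slin Hf.
pose q g := ip H (f \- g) (f \- g).
pose D := [set q g | g in S].
have infD : has_inf D.
  split; first by exists (q (fun=> 0)), (fun=> 0).
  by exists 0 => _ [g Sg <-]; apply/ip_ge0/hmemB => //; exact: SH.
have /choice[u uP] (j : nat) : exists g, S g /\ q g < inf D + j.+1%:R^-1.
  have j0 : 0 < j.+1%:R^-1 :> R by rewrite invr_gt0.
  by have [_ [g Sg <-] qg] := inf_adherent j0 infD; exists g.
have Su j : S (u j) := (uP j).1.
have Hu j : H (u j) by exact: SH.
have Hfu j : H (f \- u j) by exact: hmemB.
have almost_orth j g : S g ->
    ip H (f \- u j) g ^+ 2 <= ip H g g * j.+1%:R^-1.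
  move=> Sg; have Hg := SH _ Sg.
  have quad t : 0 <= j.+1%:R^-1 - 2 * t * ip H (f \- u j) g
                      + t ^+ 2 * ip H g g.
    have := ge_inf infD.2 (imageP q (Slin t _ _ Sg (Su j))).
    have -> : q (fun x => t * g x + u j x) =
        q (u j) - 2 * t * ip H (f \- u j) g + t ^+ 2 * ip H g g.
      have Ht := hmemZ t Hg.
      rewrite /q (_ : f \- _ = (f \- u j) \- (fun x => t * g x)); last first.
        by apply/funext => x /=; ring.
      rewrite ip_sqrB // (ip_sym _ Ht) // !ipZl // (ip_sym Hg Ht) ipZl //.
      by rewrite (ip_sym Hg) //; ring.
    move: (uP j).2; move: (j.+1%:R^-1) (inf D) (q (u j)) => eps d qj; lra.
  have := ip_ge0 Hg; rewrite le_eqVlt => /orP[/eqP g0|g0].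
    by rewrite -g0 (ip_def Hg (esym g0)) ip0r // mul0r expr0n.
  (* t = <f - u_j, g> / <g, g> minimizes the quadratic. *)
  have := quad (ip H (f \- u j) g / ip H g g).
  move=> /(mulr_ge0 (ltW g0)); rewrite -[X in _ -> is_true X]subr_ge0.
  congr (0 <= _); field.
  by rewrite nat1r pnatr_eq0 (gt_eqF g0).
have cauchyu (e : R) : 0 < e -> exists N, forall i j, (N <= i)%N -> (N <= j)%N ->
     ip H (u i \- u j) (u i \- u j) < e.
  move=> e0; have e4 : 0 < e / 4 by rewrite divr_gt0.
  have /cvgrPdist_lt/(_ _ e4)[N _ NP] := @cvg_harmonic R.
  exists N => i j Ni Nj.
  have Sg : S (u i \- u j).
    have := Slin (-1) _ _ (Su j) (Su i); congr S.
    by apply/funext => x /=; rewrite mulN1r addrC.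
  have := almost_orth i _ Sg; have := almost_orth j _ Sg.
  have := NP _ Ni; have := NP _ Nj.
  rewrite /= !sub0r !normrN !ger0_norm ?invr_ge0 //.
  set g := u i \- u j; have Hg : H g := SH _ Sg.
  have gE : ip H g g = ip H (f \- u j) g - ip H (f \- u i) g.
    by rewrite !ipBl //; ring.
  move: (ip_ge0 Hg) gE.
  set c := ip H g g; set a := ip H (f \- u j) g; set b := ip H (f \- u i) g.
  move=> c0 cE jN iN aj bi; rewrite ltNge; apply/negP => ec.
  have cc : 0 < c by apply: lt_le_trans ec.
  move: jN iN aj bi; move: (j.+1%:R^-1) (i.+1%:R^-1) => x y xe ye ax by_.
  have : c * (2 * (x + y)) < c * c by rewrite ltr_pM2l //; lra.
  have cc2 : c * c + (a + b) ^+ 2 = 2 * (a ^+ 2 + b ^+ 2) by rewrite cE; ring.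
  have := sqr_ge0 (a + b); lra.
have [f0 Hf0 uf0] := hcomplete_hcvg Hu cauchyu.
exists u, f0; split => // g Sg; have Hg := SH _ Sg.
apply/eqP; rewrite -sqrf_eq0; apply/eqP.
have lim0 : (fun j => ip H (f \- u j) g ^+ 2) @ \oo --> (0 : R).
  apply: (@squeeze_cvgr _ _ _ _ (fun=> 0)
           (fun j : nat => ip H g g * j.+1%:R^-1)).
  - by near=> j; rewrite sqr_ge0 almost_orth.
  - exact: cvg_cst.
  - by rewrite -[X in _ --> X](mulr0 (ip H g g)); apply: cvgMl_tmp; exact: cvg_harmonic.
apply: (cvg_unique (@Rhausdorff R)) lim0.
have -> : (fun j => ip H (f \- u j) g ^+ 2) =
          (fun j => (ip H f g - ip H (u j) g) ^+ 2).
  by apply/funext => j; rewrite ipBl.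
rewrite /= ipBl // expr2; under eq_fun do rewrite expr2.
by apply: cvgM; (apply: cvgB; [exact: cvg_cst|exact: hcvg_ip]).
Unshelve. all: by end_near. Qed.

End hilbert_limits.

(** * Transfer between families with the same Gram matrix *)

Definition comb (R : realType) (E I : Type) (v : I -> E -> R)
  (s : seq (R * I)) : E -> R := fun y => \sum_(p <- s) p.1 * v p.2 y.

Section span.
Context {R : realType} {E I : Type} (H : hilbert_fun R E).
Context (v : I -> E -> R) (Hv : forall i, H (v i)).

Lemma hmem_comb s : H (comb v s).
Proof. by apply: hmem_sum => p. Qed.

Lemma ip_comb s h : H h -> ip H (comb v s) h = \sum_(p <- s) p.1 * ip H (v p.2) h.
Proof. by move=> Hh; apply: ip_suml => // p. Qed.

Lemma span_projection f : H f ->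
  exists s f0, [/\ H f0, hcvg H (fun j => comb v (s j)) f0 &
    forall i, ip H (f \- f0) (v i) = 0].
Proof.
move=> Hf; pose S g := exists s, g = comb v s.
have [|||u [f0 [Su Hf0 uf0 orth]]] := @projection_exists _ _ H S f _ _ _ Hf.
- by move=> _ [s ->]; exact: hmem_comb.
- by exists [::]; apply/funext => y; rewrite /comb big_nil.
- move=> a _ _ [s ->] [t ->].
  exists ([seq (a * p.1, p.2) | p <- s] ++ t); apply/funext => y.
  rewrite /comb big_cat big_map mulr_sumr; congr (_ + _).
  by apply: eq_bigr => p _; rewrite mulrA.
have [s us] := choice Su.
exists s, f0; split => //; first by rewrite -(funext us).
move=> i; apply: orth; exists [:: (1, i)].
by apply/funext => y; rewrite /comb big_seq1 mul1r.
Qed.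

End span.

Lemma bounded_op_hcvg (R : realType) (I E1 E2 : Type) (H1 : hilbert_fun R E1)
    (H2 : hilbert_fun R E2) (v : I -> E1 -> R) (w : I -> E2 -> R) B s f :
  (forall i, H1 (v i)) -> linear_op H1 H2 B -> bounded_op H1 H2 B ->
  (forall i, B (v i) = w i) -> H1 f -> hcvg H1 (fun j => comb v (s j)) f ->
  hcvg H2 (fun j => comb w (s j)) (B f).
Proof.
move=> Hv [HB Blin] [C BC] Bv Hf sf.
have B0 : B (fun=> 0) = fun=> 0.
  have := Blin (-1) _ _ (hmem0 H1) (hmem0 H1).
  rewrite (_ : (fun x => -1 * 0 + 0) = fun=> 0 :> R) => [->|]; last first.
    by apply/funext => x; rewrite mulr0 addr0.
  by apply/funext => y; rewrite mulN1r addNr.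
have Bcomb t : B (comb v t) = comb w t.
  elim: t => [|[a i] t IH].
    rewrite (_ : comb v [::] = fun=> 0) ?B0; apply/funext => y;
      by rewrite /comb big_nil.
  rewrite (_ : comb v _ = fun y => a * v i y + comb v t y); last first.
    by apply/funext => y; rewrite /comb big_cons.
  rewrite Blin //; last exact: hmem_comb.
  by apply/funext => y; rewrite IH Bv /comb big_cons.
have BB g h : H1 g -> H1 h -> B (g \- h) = B g \- B h.
  move=> Hg Hh; have := Blin (-1) _ _ Hh Hg.
  rewrite (_ : (fun x => -1 * h x + g x) = g \- h) => [->|]; last first.
    by apply/funext => x; rewrite mulN1r addrC.
  by apply/funext => y; rewrite mulN1r addrC.
apply: (@squeeze_cvgr _ _ _ _ (fun=> 0)
  (fun j => C * hnorm H1 (comb v (s j) \- f))).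
- near=> j; rewrite hnorm_ge0 /= -Bcomb -BB //; last exact: hmem_comb.
  by apply: BC; apply: hmemB => //; exact: hmem_comb.
- exact: cvg_cst.
- by rewrite -[X in _ --> X](mulr0 C); apply: cvgMl_tmp.
Unshelve. all: by end_near. Qed.

Section gram_transfer.
Context {R : realType} {I E1 E2 : Type}.
Context (H1 : hilbert_fun R E1) (H2 : hilbert_fun R E2).
Context (v : I -> E1 -> R) (w : I -> E2 -> R).
Context (Hv : forall i, H1 (v i)) (Hw : forall i, H2 (w i)).
Context (gram : forall i j, ip H1 (v i) (v j) = ip H2 (w i) (w j)).

Lemma ip_comb_gram s t :
  ip H1 (comb v s) (comb v t) = ip H2 (comb w s) (comb w t).
Proof.
have comb1 i : ip H1 (v i) (comb v t) = ip H2 (w i) (comb w t).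
  rewrite (ip_sym (Hv i)) ?(ip_sym (Hw i)) ?ip_comb //; try exact: hmem_comb.
  by apply: eq_bigr => p _; rewrite gram.
rewrite !ip_comb //; try exact: hmem_comb.
by apply: eq_bigr => p _; rewrite comb1.
Qed.

(** The element g is the copy in H2 of the projection of f on the closed span of
    v.  It lies in the closed span of w, which is what the last clause
    says in the form used below. *)
Lemma gram_transfer f : H1 f ->
  exists g, [/\ H2 g, forall i, ip H2 g (w i) = ip H1 f (v i),
    hnorm H2 g <= hnorm H1 f &
    forall h, H2 h -> (forall i, ip H2 h (w i) = 0) -> ip H2 g h = 0].
Proof.
move=> Hf; have [s [f0 [Hf0 sf0 orth]]] := span_projection Hv Hf.
have Hvs j : H1 (comb v (s j)) by exact: hmem_comb.
have Hws j : H2 (comb w (s j)) by exact: hmem_comb.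
have [g Hg sg] : exists2 g, H2 g & hcvg H2 (fun j => comb w (s j)) g.
  apply: hcomplete_hcvg => // e /(hcvg_cauchy Hvs Hf0 sf0)[N NP].
  exists N => i j Ni Nj; move: (NP i j Ni Nj).
  by rewrite !ip_sqrB // !ip_comb_gram.
have gf0 i : ip H2 g (w i) = ip H1 f0 (v i).
  have := hcvg_ip Hvs Hf0 (Hv i) sf0; apply: (cvg_unique (@Rhausdorff R)) => /=.
  have -> : (fun j => ip H1 (comb v (s j)) (v i)) =
            (fun j => ip H2 (comb w (s j)) (w i)).
    apply/funext => j; rewrite !ip_comb //.
    by apply: eq_bigr => p _; rewrite gram.
  exact: hcvg_ip.
have normg : ip H2 g g = ip H1 f0 f0.
  have := hcvg_sqr Hvs Hf0 sf0; apply: (cvg_unique (@Rhausdorff R)) => /=.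
  under eq_fun do rewrite ip_comb_gram.
  exact: hcvg_sqr.
exists g; split => //.
- move=> i; rewrite gf0; apply/esym/eqP.
  by rewrite -subr_eq0 -ipBl // orth.
- rewrite /hnorm ler_sqrt ?ip_ge0 // normg.
  have Hff0 := hmemB Hf Hf0.
  have f0orth : ip H1 f0 (f \- f0) = 0.
    apply: (cvg_unique (@Rhausdorff R) (hcvg_ip Hvs Hf0 Hff0 sf0)) => /=.
    have -> : (fun j => ip H1 (comb v (s j)) (f \- f0)) = (fun=> 0).
      apply/funext => j; rewrite ip_comb // big1 // => p _.
      by rewrite ip_sym // orth mulr0.
    exact: cvg_cst.
  have -> : f = f0 \+ (f \- f0) by apply/funext => y /=; rewrite addrC subrK.
  by rewrite (ip_sqrD Hf0 Hff0) f0orth mulr0 addr0 lerDl ip_ge0.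
- move=> h Hh horth; apply: (cvg_unique (@Rhausdorff R) (hcvg_ip Hws Hg Hh sg)) => /=.
  have -> : (fun j => ip H2 (comb w (s j)) h) = (fun=> 0).
    apply/funext => j; rewrite ip_comb // big1 // => p _.
    by rewrite ip_sym // horth mulr0.
  exact: cvg_cst.
Qed.

End gram_transfer.

(** A vector orthogonal to all generators vanishes at every point by the
    reproducing property, so f equals its projection on their closed span. *)
Lemma rkhs_dense (R : realType) (E : Type) (K : E -> E -> R)
    (H : hilbert_fun R E) f : is_rkhs K H -> H f ->
  exists s, hcvg H (fun j => comb (generator K) (s j)) f.
Proof.
move=> [HK repr] Hf; have [s [f0 [Hf0 sf0 orth]]] := span_projection HK Hf.
exists s; suff -> : f = f0 by [].
apply/funext => x; apply/eqP; rewrite -subr_eq0 -(orth x).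
by rewrite repr //; exact: hmemB.
Qed.

(** The quadratic form of a Gram kernel is a squared norm. *)
Lemma gram_kernel (R : realType) (E1 E2 : Type) (H : hilbert_fun R E1)
    (m : E2 -> E1 -> R) (K : E2 -> E2 -> R) : (forall x, H (m x)) ->
  (forall x y, K x y = ip H (m x) (m y)) -> reproducing_kernel K.
Proof.
move=> Hm KE; split=> [x y|N x c]; first by rewrite !KE ip_sym.
pose v i := m (x i); have Hv i : H (v i) by exact: Hm.
have Hs := hmem_sum (index_enum 'I_N) c Hv.
have := ip_ge0 Hs; rewrite (ip_suml _ _ Hv Hs).
congr (0 <= _); apply: eq_bigr => i _.
rewrite (ip_sym (Hv i) Hs) (ip_suml _ _ Hv (Hv i)) mulr_sumr.
by apply: eq_bigr => j _; rewrite mulrA KE (ip_sym (Hm (x j))).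
Qed.

(** * The analysis operator of a family and its adjoint *)

(** The minimal norm right inverse: orthogonality to the null space makes A g
    unique, which is the reason for recording it here. *)
Definition orthogonal_section (R : realType) (E1 E2 : Type)
    (H : hilbert_fun R E1) (Ht : hilbert_fun R E2)
    (T : (E1 -> R) -> E2 -> R) (A : (E2 -> R) -> E1 -> R) : Prop :=
  forall g, Ht g -> [/\ H (A g), T (A g) = g, hnorm H (A g) = hnorm Ht g &
    forall h, null_space H T h -> ip H (A g) h = 0].

Section coisometry.
Context {R : realType} {E1 E2 : Type}.
Context (H : hilbert_fun R E1) (Ht : hilbert_fun R E2).
Context (m : E2 -> E1 -> R) (Kt : E2 -> E2 -> R) (T : (E1 -> R) -> E2 -> R).
Context (Hm : forall x, H (m x)) (KtE : forall x y, Kt x y = ip H (m x) (m y)).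
Context (HtK : is_rkhs Kt Ht) (TE : forall f x, H f -> T f x = ip H f (m x)).

Let kt := generator Kt.
Let Htk x : Ht (kt x) := HtK.1 x.
Let repr g x : Ht g -> ip Ht g (kt x) = g x := @HtK.2 g x.

Let gram x y : ip H (m x) (m y) = ip Ht (kt x) (kt y).
Proof. by rewrite repr // -KtE /kt /generator KtE (ip_sym (Hm x)). Qed.

(** The transfer g of f to Ht satisfies g(x) = <g, Kt(., x)> = <f, m_x>, so it
    is T f itself. *)
Lemma transform_hmem_le f : H f -> Ht (T f) /\ hnorm Ht (T f) <= hnorm H f.
Proof.
move=> Hf; have [g [Htg gE gf _]] := gram_transfer Hm Htk gram Hf.
suff -> : T f = g by [].
by apply/funext => x; rewrite TE // -gE repr.
Qed.

Lemma transform_linear a f g : H f -> H g ->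
  T (fun x => a * f x + g x) = (fun y => a * T f y + T g y).
Proof.
move=> Hf Hg; apply/funext => y.
by rewrite !TE ?ip_linl //; exact: hmem_lin.
Qed.

Lemma transform_linear_op : linear_op H Ht T.
Proof.
by split=> [f /transform_hmem_le[]//|a f g Hf Hg]; exact: transform_linear.
Qed.

(** The transfer from Ht to H does not increase norms and T does not either, so
    the lift of g has exactly the norm of g. *)
Lemma orthogonal_section_exists : exists A, orthogonal_section H Ht T A.
Proof.
suff lift g : exists f, Ht g -> [/\ H f, T f = g, hnorm H f = hnorm Ht g &
    forall h, null_space H T h -> ip H f h = 0].
  by have [A AP] := choice lift; exists A.
have [Htg|nHtg] := pselect (Ht g); last by exists (fun=> 0).
have [f [Hf fE fg orth]] :=
  gram_transfer Htk Hm (fun x y => esym (gram x y)) Htg.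
have Tf : T f = g by apply/funext => x; rewrite TE // fE repr.
exists f => _; split => //.
  apply/eqP; rewrite eq_le fg -Tf.
  by have [_ ->] := transform_hmem_le Hf.
by move=> h [Hh Th]; apply: orth => // x; rewrite -TE // Th.
Qed.

Context (A : (E2 -> R) -> E1 -> R).
Context (AP : orthogonal_section H Ht T A).

Let HA g : Ht g -> H (A g). Proof. by case/AP. Qed.
Let TA g : Ht g -> T (A g) = g. Proof. by case/AP. Qed.
Let HtT f : H f -> Ht (T f). Proof. by case/transform_hmem_le. Qed.

Lemma transformB f g : H f -> H g -> T (f \- g) = T f \- T g.
Proof.
move=> Hf Hg; apply/funext => y /=.
by rewrite !TE ?ipBl //; exact: hmemB.
Qed.

Lemma lift_unique f g : H f -> Ht g -> T f = g ->
  (forall h, null_space H T h -> ip H f h = 0) -> f = A g.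
Proof.
move=> Hf Htg Tf orth; have [Ha Ta _ aorth] := AP Htg.
have Nfa : null_space H T (f \- A g).
  split; first exact: hmemB.
  by rewrite transformB // Tf Ta; apply/funext => y /=; rewrite subrr.
apply: (ip_sub_eq0 Hf Ha); rewrite ipBl //; last exact: Nfa.1.
by rewrite orth // aorth // subrr.
Qed.

(** a A f + A g has image a f + g and is orthogonal to the null space, so it is
    the value of A there. *)
Lemma lift_linear_op : linear_op Ht H A.
Proof.
split=> [g /HA //|a f g Htf Htg]; apply/esym/lift_unique.
- by apply: hmem_lin; exact: HA.
- exact: hmem_lin.
- rewrite transform_linear; try exact: HA.
  by rewrite !TA.
- move=> h Nh; have [_ _ _ fo] := AP Htf; have [_ _ _ go] := AP Htg.
  by rewrite ip_linl ?fo ?go ?mulr0 ?addr0 //; try exact: HA; exact: Nh.1.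
Qed.

Lemma lift_transform_null f : H f -> null_space H T (f \- A (T f)).
Proof.
move=> Hf; have HATf := HA (HtT Hf).
split; first exact: hmemB.
rewrite transformB // TA; last exact: HtT.
by apply/funext => y /=; rewrite subrr.
Qed.

(** Polarization of the isometry property. *)
Lemma lift_ip f g : Ht f -> Ht g -> ip H (A f) (A g) = ip Ht f g.
Proof.
move=> Htf Htg; have sqrA h : Ht h -> ip H (A h) (A h) = ip Ht h h.
  move=> Hth; rewrite -(sqr_hnorm (HA Hth)) -(sqr_hnorm Hth).
  by case: (AP Hth) => _ _ ->.
have AD : A (f \+ g) = A f \+ A g.
  have := lift_linear_op.2 1 f g Htf Htg.
  rewrite (_ : (fun x => 1 * f x + g x) = f \+ g); last first.
    by apply/funext => x; rewrite mul1r.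
  by move=> ->; apply/funext => x; rewrite mul1r.
have := sqrA _ (hmemD Htf Htg).
rewrite AD (ip_sqrD (HA Htf) (HA Htg)) (ip_sqrD Htf Htg) !sqrA //; lra.
Qed.

(** A g only sees the component A (T f) of f. *)
Lemma lift_adjoint : is_adjoint H Ht T A.
Proof.
split=> [g /HA //|f g Hf Htg]; have HATf := HA (HtT Hf).
have [_ _ _ /(_ _ (lift_transform_null Hf)) orth] := AP Htg.
rewrite -lift_ip //; last exact: HtT.
have HN := hmemB Hf HATf; have HAg := HA Htg.
apply/esym/eqP; rewrite -subr_eq0 -ipBl //; apply/eqP.
by rewrite (ip_sym HN HAg) orth.
Qed.

Lemma lift_generator x : A (kt x) = m x.
Proof.
apply/esym/lift_unique => //.
- apply/funext => y; rewrite TE // -KtE /kt /generator KtE.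
  by rewrite (ip_sym (Hm x)) // KtE.
- by move=> h [Hh Th]; rewrite ip_sym // -TE // Th.
Qed.

(** Both operators map combinations of generators that converge to g to the same
    combinations of the vectors m_x. *)
Lemma bounded_op_unique B : linear_op Ht H B -> bounded_op Ht H B ->
  (forall x, B (kt x) = m x) -> forall g, Ht g -> B g = A g.
Proof.
move=> linB bndB Bk g Htg; have [s sg] := rkhs_dense HtK Htg.
have bndA : bounded_op Ht H A.
  by exists 1 => f Htf; case: (AP Htf) => _ _ -> _; rewrite mul1r.
have Hs j : H (comb m (s j)) by exact: hmem_comb.
have limB := bounded_op_hcvg Htk linB bndB Bk Htg sg.
have limA := bounded_op_hcvg Htk lift_linear_op bndA lift_generator Htg sg.
apply: (hcvg_unique Hs _ _ limB limA); [exact: linB.1|exact: HA].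
Qed.

Lemma lift_range_orthocompl :
  op_range Ht A = orthocompl H (null_space H T).
Proof.
apply/seteqP; split=> [_ [g Htg <-]|f [Hf orth]].
  by split; [exact: HA|have [] := AP Htg].
exists (T f); first exact: HtT.
by apply/esym/lift_unique => //; exact: HtT.
Qed.

Lemma orthocompl_lift_range :
  orthocompl H (op_range Ht A) = null_space H T.
Proof.
apply/seteqP; split=> [f [Hf orth]|f [Hf Tf]]; split=> //.
  apply/funext => x; rewrite TE // -lift_generator orth //.
  by exists (kt x) => //; exact: Htk.
move=> _ [g Htg <-]; have [HAg _ _ orth] := AP Htg.
by rewrite ip_sym // orth.
Qed.

Lemma lift_decomposition f : H f ->
  [/\ op_range Ht A (A (T f)), null_space H T (f \- A (T f)),
     f = A (T f) \+ (f \- A (T f)),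
     (forall u v, op_range Ht A u -> null_space H T v -> f = u \+ v ->
        u = A (T f) /\ v = f \- A (T f)) &
     op_range Ht A f <-> f = A (T f)].
Proof.
move=> Hf; split.
- by exists (T f) => //; exact: HtT.
- exact: lift_transform_null.
- by apply/funext => x /=; rewrite addrC subrK.
- move=> _ v [g Htg <-] [Hv Tv] fE.
  have HAg := HA Htg.
  have Tf : T f = g.
    apply/funext => x.
    by rewrite TE // fE ipDl // -!TE // TA // Tv addr0.
  split; first by rewrite Tf.
  by rewrite Tf fE; apply/funext => x /=; rewrite addrAC subrr add0r.
- split=> [[g Htg <-]|fE]; first by rewrite TA.
  by exists (T f) => //; exact: HtT.
Qed.

Lemma lift_fiber g : Ht g ->
  [set f | H f /\ g = T f] = [set A g \+ h | h in null_space H T].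
Proof.
move=> Htg; apply/seteqP; split=> [f [Hf ->]|_ [h [Hh Th] <-]] /=.
  exists (f \- A (T f)); first exact: lift_transform_null.
  by apply/funext => x /=; rewrite addrC subrK.
have HAg := HA Htg; split; first exact: hmemD.
apply/funext => x; rewrite TE; last exact: hmemD.
by rewrite ipDl // -!TE // TA // Th addr0.
Qed.

Lemma lift_min_norm g : Ht g ->
  is_min [set hnorm H f | f in [set f | H f /\ g = T f]] (hnorm H (A g)).
Proof.
move=> Htg; split; first by exists (A g) => //=; rewrite TA //; split=> //; exact: HA.
move=> _ [f [Hf ->] <-]; have [_ _ -> _] := AP (HtT Hf).
by have [] := transform_hmem_le Hf.
Qed.

End coisometry.

(** * Bochner integrals and inner products *)

Section bochner_duality.
Context {R : realType} d (T : measurableType d) (mu : {measure set T -> \bar R}).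
Context (E : Type) (H : hilbert_fun R E) (D : set T) (mD : measurable D).

(** Monotonicity for arbitrary nonnegative functions, whose integral is a
    supremum over the simple functions below them.  It is used with an
    upper bound g which is the norm of a vector-valued function, where
    measurability of g would need an argument of its own. *)
Lemma ge0_le_integral_nonmeasurable (f g : T -> \bar R) :
  (forall z, D z -> 0 <= f z)%E -> (forall z, D z -> f z <= g z)%E ->
  (\int[mu]_(z in D) f z <= \int[mu]_(z in D) g z)%E.
Proof.
move=> f0 fg; rewrite !ge0_integralE //; last first.
  by move=> z Dz; exact: le_trans (f0 _ Dz) (fg _ Dz).
apply: ereal_sup_le => _ [h hf <-]; exists h => // z.
apply: le_trans (hf z) _.
by apply: lee_restrict.
Qed.

Lemma is_simple_cons p s : is_simple mu H (p :: s) ->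
  [/\ measurable p.1, (mu p.1 < +oo)%E & H p.2] /\ is_simple mu H s.
Proof.
by move=> ps; split=> [|i si]; [exact: (ps 0%N)|exact: (ps i.+1)].
Qed.

Lemma hmem_simple s z : is_simple mu H s -> H (simple_eval s z).
Proof.
elim: s => [_|p s IH /is_simple_cons[[_ _ Hp] /IH Hs]].
  have := hmem0 H; congr (hmem H _).
  by apply/funext => y; rewrite /simple_eval big_nil.
have := hmem_lin (\1_(p.1) z) Hp Hs; congr (hmem H _).
by apply/funext => y; rewrite /simple_eval big_cons.
Qed.

Lemma hmem_simple_integral s : is_simple mu H s -> H (simple_integral mu D s).
Proof.
elim: s => [_|p s IH /is_simple_cons[[_ _ Hp] /IH Hs]].
  have := hmem0 H; congr (hmem H _).
  by apply/funext => y; rewrite /simple_integral big_nil.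
have := hmem_lin (fine (mu (p.1 `&` D))) Hp Hs; congr (hmem H _).
by apply/funext => y; rewrite /simple_integral big_cons.
Qed.

Lemma simple_ip_integral s h : is_simple mu H s -> H h ->
  mu.-integrable D (fun z => (ip H (simple_eval s z) h)%:E) /\
  \int[mu]_(z in D) ip H (simple_eval s z) h = ip H (simple_integral mu D s) h.
Proof.
move=> + Hh; elim: s => [_|p s IH /is_simple_cons[[mp pfin Hp] ps]].
  have e0 z : ip H (simple_eval [::] z) h = 0.
    by rewrite -[RHS](ip0l Hh); congr ip; apply/funext => y;
      rewrite /simple_eval big_nil.
  have i0 : ip H (simple_integral mu D [::]) h = 0.
    by rewrite -[RHS](ip0l Hh); congr ip; apply/funext => y;
      rewrite /simple_integral big_nil.
  rewrite i0; under eq_fun do rewrite e0; split; first exact: integrable0.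
  by rewrite /Rintegral; under eq_integral do rewrite e0; rewrite integral0.
have [ints sE] := IH ps.
have eE z : ip H (simple_eval (p :: s) z) h =
    \1_(p.1) z * ip H p.2 h + ip H (simple_eval s z) h.
  rewrite -ip_linl //; last exact: hmem_simple.
  by congr ip; apply/funext => y; rewrite /simple_eval big_cons.
have iE : ip H (simple_integral mu D (p :: s)) h =
    fine (mu (p.1 `&` D)) * ip H p.2 h + ip H (simple_integral mu D s) h.
  rewrite -ip_linl //; last exact: hmem_simple_integral.
  by congr ip; apply/funext => y; rewrite /simple_integral big_cons.
have indp : mu.-integrable D (fun z => (\1_(p.1) z : R)%:E).
  apply/integrableP; split.
    by apply/measurable_EFinP; exact: measurable_indic.
  under eq_integral do rewrite gee0_abs ?lee_fin //.
  rewrite integral_indic //; apply: le_lt_trans pfin.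
  by apply: le_measure; rewrite ?inE //; exact: measurableI.
have indpZ : mu.-integrable D (fun z => (\1_(p.1) z * ip H p.2 h)%:E).
  under eq_fun do rewrite mulrC EFinM; exact: integrableZl.
split.
  by under eq_fun do rewrite eE EFinD; exact: integrableD.
rewrite iE -sE (_ : \int[mu]_(z in D) _ = \int[mu]_(z in D)
   (\1_(p.1) z * ip H p.2 h + ip H (simple_eval s z) h)); last first.
  by apply: eq_Rintegral => z _; rewrite eE.
rewrite RintegralD //; congr (_ + _).
by rewrite RintegralZr //; congr (_ * _); rewrite /Rintegral integral_indic.
Qed.

(** Pairing with f is exact on simple functions, and by Cauchy-Schwarz the
    errors made on both sides when F is replaced by the simple functions s_j
    tend to 0. *)
Lemma bochner_integral_ip F m f : is_bochner_integral mu H D F m -> H f ->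
  mu.-integrable D (fun z => (ip H (F z) f)%:E) ->
  \int[mu]_(z in D) ip H (F z) f = ip H m f.
Proof.
move=> [HF Hm [s [ss _ sF sm]]] Hf intF.
have Hs j z : H (simple_eval (s j) z) by exact: hmem_simple.
have HI j : H (simple_integral mu D (s j)) by exact: hmem_simple_integral.
(* The summand 1 keeps c invertible when f = 0. *)
pose c := hnorm H f + 1.
have c0 : 0 < c by rewrite ltr_wpDl ?hnorm_ge0.
set I := LHS.
have bound j : (`|ip H (simple_integral mu D (s j)) f - I|%:E <=
   c%:E * \int[mu]_(z in D) (hnorm H (F z \- simple_eval (s j) z))%:E)%E.
  have [ints <-] := simple_ip_integral (ss j) Hf.
  have intd : mu.-integrable D (fun z => (ip H (F z \- simple_eval (s j) z) f)%:E).
    apply: (eq_integrable mD _ _ _ (integrableB mD intF ints)) => z zD.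
    by rewrite ipBl //; exact/HF/set_mem.
  rewrite distrC /I -RintegralB //.
  have -> : \int[mu]_(z in D) (ip H (F z) f - ip H (simple_eval (s j) z) f) =
      \int[mu]_(z in D) ip H (F z \- simple_eval (s j) z) f.
    by apply: eq_Rintegral => z zD; rewrite ipBl //; exact/HF/set_mem.
  rewrite -lee_pdivrMl //.
  have intdc := integrableZl mD c^-1 (integrable_abse intd).
  apply: (@le_trans _ _
    (\int[mu]_(z in D) (c^-1%:E * `|(ip H (F z \- simple_eval (s j) z) f)%:E|))%E).
    rewrite integralZl ?integrable_abse //.
    rewrite lee_pmul2l //; last by rewrite lte_fin invr_gt0.
    have := le_abse_integral mu mD (measurable_int mu intd).
    by rewrite -[X in (`|X| <= _)%E -> _]fineK ?integrable_fin_num.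
  apply: ge0_le_integral_nonmeasurable => z Dz.
    by rewrite mule_ge0 // lee_fin invr_ge0 ltW.
  rewrite lee_fin ler_pdivrMl // mulrC.
  have Hd := hmemB (HF _ Dz) (Hs j z).
  apply: le_trans (normr_ip_le Hd Hf) _.
  by rewrite ler_wpM2l ?hnorm_ge0 // lerDl.
have limI : (fun j => ip H (simple_integral mu D (s j)) f) @ \oo --> I.
  apply/subr_cvg0/norm_cvg0P.
  suff /fine_cvgP[] : (fun j => `|ip H (simple_integral mu D (s j)) f - I|%:E)
     @ \oo --> 0%E by [].
  apply: (@squeeze_cvge _ _ _ _ (fun=> 0%E) _ (fun j => c%:E *
      \int[mu]_(z in D) (hnorm H (F z \- simple_eval (s j) z))%:E)%E).
  - by near=> j; apply/andP; split; [rewrite lee_fin|exact: bound].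
  - exact: cvg_cst.
  - by rewrite -[X in _ --> X](mule0 c%:E); exact: cvgeZl.
exact: (cvg_unique (@Rhausdorff R) limI (hcvg_ip HI Hm Hf sm)).
Unshelve. all: by end_near. Qed.

End bochner_duality.

(** * Measurability of Euclidean balls *)

Section ball_measurable.
Context {R : realType} {k : nat}.

Definition box_below (i : 'I_k) (a : R) (c : option ('cV[R]_k * 'cV[R]_k)) :=
  omap (fun pq : 'cV[R]_k * 'cV[R]_k =>
    (pq.1, \col_j if j == i then Num.min (pq.2 j 0) a else pq.2 j 0)) c.

Definition box_above (i : 'I_k) (a : R) (c : option ('cV[R]_k * 'cV[R]_k)) :=
  omap (fun pq : 'cV[R]_k * 'cV[R]_k =>
    (\col_j (if j == i then Num.max (pq.1 j 0) a else pq.1 j 0), pq.2)) c.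

Lemma box_belowE i a c : box c `&` [set v | v i 0 <= a] `<=` box (box_below i a c).
Proof.
case: c => [[p q]|] v [] //= cv va j; rewrite mxE.
case: eqP => [->|_]; last exact: cv.
by rewrite le_min va andbT; exact: cv.
Qed.

Lemma box_aboveE i a c :
  box c `&` ~` [set v | v i 0 <= a] `<=` box (box_above i a c).
Proof.
case: c => [[p q]|] v [] //= cv /negP; rewrite -ltNge => /ltW va j.
rewrite mxE; case: eqP => [->|_]; last exact: cv.
by rewrite ge_max va andbT; exact: cv.
Qed.

Lemma box_volume_split i a c :
  box_volume (box_below i a c) + box_volume (box_above i a c) = box_volume c.
Proof.
case: c => [[p q]|] /=; last by rewrite addr0.
rewrite (bigD1 i) //= [X in _ + X](bigD1 i) //= [RHS](bigD1 i) //=.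
rewrite !mxE eqxx.
have others (f : 'I_k -> R) : (forall j, j != i ->
     f j = Num.max 0 (q j 0 - p j 0)) ->
   \prod_(j < k | j != i) f j =
   \prod_(j < k | j != i) Num.max 0 (q j 0 - p j 0).
  by move=> fE; apply: eq_bigr.
rewrite others; last by move=> j /negbTE ji; rewrite mxE ji.
rewrite [X in _ + _ * X]others; last by move=> j /negbTE ji; rewrite mxE ji.
rewrite -mulrDl; congr (_ * _); rewrite /Num.max /Num.min.
by case: (ltP (q i 0) a) => ?; case: (ltP (p i 0) a) => ?;
  repeat (case: ltP => ?); lra.
Qed.

(** Splitting each box of a covering of X by the half-space yields coverings of
    the two parts of X with the same total volume, which is the Caratheodory
    criterion.  Both pieces of a box are closed; they may
    overlap in a face, and that costs no volume. *)
Lemma measurable_halfspace (i : 'I_k) (a : R) :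
  measurable ([set v | v i 0 <= a] : set (Leb R k)).
Proof.
apply: le_caratheodory_measurable => X /=.
apply: le_ereal_inf_tmp => _ [c Xc <-].
have -> : (\sum_(j <oo) (box_volume (c j))%:E =
   \sum_(j <oo) (box_volume (box_below i a (c j)))%:E +
   \sum_(j <oo) (box_volume (box_above i a (c j)))%:E)%E.
  rewrite -nneseriesD; [|by move=> j _ _; rewrite lee_fin box_volume_ge0..].
  by apply: eq_eseriesr => j _; rewrite -EFinD box_volume_split.
apply: leeD; apply: ereal_inf_lbound.
- exists (fun j => box_below i a (c j)) => // v [/Xc[j _ cv] va].
  by exists j => //; exact: box_belowE.
- exists (fun j => box_above i a (c j)) => // v [/Xc[j _ cv] va].
  by exists j => //; exact: box_aboveE.
Qed.

Lemma measurable_coord (i : 'I_k) :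
  measurable_fun setT (fun v : Leb R k => (v : 'cV[R]_k) i 0).
Proof.
move=> mD; apply: (measurability _ (RGenOInfty.measurableE R)) => //.
move=> _ [_ [a ->] <-]; rewrite setTI.
rewrite (_ : _ @^-1` _ = ~` [set v : Leb R k | (v : 'cV[R]_k) i 0 <= a]).
  exact/measurableC/measurable_halfspace.
apply/seteqP; split=> v /=; rewrite in_itv /= andbT ltNge; first by move/negP.
by move/negP.
Qed.

Lemma measurable_cball (r : R) : measurable (cball r : set (Leb R k)).
Proof.
have msum : measurable_fun setT
    (fun v : Leb R k => \sum_i (v : 'cV[R]_k) i 0 ^+ 2).
  apply: measurable_sum => i; apply: measurable_funX; exact: measurable_coord.
have mnorm : measurable_fun setT (fun v : Leb R k => enorm (v : 'cV[R]_k)).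
  have msqrt : measurable_fun setT (@Num.sqrt R).
    by apply: continuous_measurable_fun; exact: sqrt_continuous.
  exact: (measurableT_comp msqrt msum).
have := mnorm measurableT _ (measurable_itv `]-oo, r]).
by rewrite setTI (_ : _ @^-1` _ = cball r).
Qed.

End ball_measurable.

(** * The plane transform *)

Section plane.
Context {R : realType} {n k : nat} (hkn : (k <= n)%N).
Context (K : uball R n -> uball R n -> R) (H : hilbert_fun R (uball R n)).
Context (hH : is_rkhs K H) (Q : 'M[R]_n).
Context (hint : plane_integrals_exist hkn Q K H).

Lemma generator_integralE x m f : is_generator_integral hkn Q K H x m -> H f ->
  plane_transform hkn Q f x = ip H f m.
Proof.
move=> xm Hf; have [Hk Hm _] := xm.
have reprC z : ip H (generator K (plane_point hkn Q x z)) f =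
    f (plane_point hkn Q x z).
  by rewrite ip_sym // ?hH.2 //; exact: hH.1.
rewrite (ip_sym Hf Hm).
rewrite -(bochner_integral_ip (measurable_cball (W x)) xm Hf).
  by apply: eq_Rintegral => z _; rewrite reprC.
apply: (eq_integrable (measurable_cball (W x)) _ _ _
  (transform_integrable hint x Hf)) => z _.
by rewrite reprC.
Qed.

(** All pairings of m with H are prescribed by the plane transform. *)
Lemma generator_integral_unique x m m' : is_generator_integral hkn Q K H x m ->
  is_generator_integral hkn Q K H x m' -> m = m'.
Proof.
move=> xm xm'; have [_ Hm _] := xm; have [_ Hm' _] := xm'.
have Hd := hmemB Hm Hm'; apply: (ip_sub_eq0 Hm Hm').
by rewrite ipBr // -(generator_integralE xm Hd) -(generator_integralE xm' Hd) subrr.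
Qed.

(** The inner integral is the transform at x of a generator of K, that is the
    value of m_x at the point of the generator; the outer one is then the
    transform of m_x at y. *)
Lemma induced_kernel_gram m :
  (forall x, is_generator_integral hkn Q K H x (m x)) ->
  forall x y, induced_kernel hkn Q K x y = ip H (m x) (m y).
Proof.
move=> mP x y; have Hm z : H (m z) by case: (mP z).
rewrite -(generator_integralE (mP y) (Hm x)).
apply: eq_Rintegral => z _.
rewrite -[LHS]/(plane_transform hkn Q (generator K (plane_point hkn Q y z)) x).
have Hk := hH.1 (plane_point hkn Q y z).
by rewrite (generator_integralE (mP x) Hk) ip_sym // hH.2.
Qed.

End plane.

Theorem theorem6p1 (R : realType) (n k : nat)
    (hn : (2 <= n)%N) (hk : (1 <= k)%N) (hkn : (k <= n)%N)
    (K : uball R n -> uball R n -> R) (hK : reproducing_kernel K)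
    (H : hilbert_fun R (uball R n)) (hH : is_rkhs K H)
    (Q : 'M[R]_n) (hQ : SO R n Q)
    (hint : plane_integrals_exist hkn Q K H) :
  let KQ := plane_transform hkn Q in
  let Kt := induced_kernel hkn Q K in
  reproducing_kernel Kt /\
  forall Ht : hilbert_fun R (uball R (n - k)), is_rkhs Kt Ht ->
    [/\ linear_op H Ht KQ, contractive_op H Ht KQ & surjective_op H Ht KQ] /\
    exists A : (uball R (n - k) -> R) -> (uball R n -> R),
      is_adjoint H Ht KQ A /\
      (linear_op Ht H A /\ isometric_op Ht H A) /\
      ((forall x, is_generator_integral hkn Q K H x (A (generator Kt x))) /\
       (forall B, linear_op Ht H B -> bounded_op Ht H B ->
          (forall x, is_generator_integral hkn Q K H x (B (generator Kt x))) ->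
          forall g, Ht g -> B g = A g)) /\
      let HQ := op_range Ht A in
      let N := null_space H KQ in
      (* (1) *)
      (forall g, Ht g -> KQ (A g) = g) /\
      (* (2) *)
      (HQ = orthocompl H N /\ orthocompl H HQ = N) /\
      (* (3) *)
      (forall f, H f ->
         [/\ HQ (A (KQ f)),
             N (f \- A (KQ f)),
             f = A (KQ f) \+ (f \- A (KQ f)),
             (forall u v, HQ u -> N v -> f = u \+ v ->
                u = A (KQ f) /\ v = f \- A (KQ f)) &
             HQ f <-> f = A (KQ f)]) /\
      (* (4) *)
      (forall g, Ht g ->
         [set f | H f /\ g = KQ f] = [set A g \+ h | h in N] /\
         hnorm Ht g = hnorm H (A g) /\
         is_min [set hnorm H f | f in [set f | H f /\ g = KQ f]]
           (hnorm H (A g))).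
Proof.
move=> KQ Kt.
have [m mP] := choice (generator_integrable hint).
have Hm x : H (m x) by case: (mP x).
have KQE f x : H f -> KQ f x = ip H f (m x).
  by move=> Hf; exact: (generator_integralE hH hint (mP x) Hf).
have KtE x y : Kt x y = ip H (m x) (m y).
  exact: (induced_kernel_gram hH hint mP).
split=> [|Ht HtK]; first exact: gram_kernel KtE.
have [A AP] := orthogonal_section_exists Hm KtE HtK KQE.
have Ak := lift_generator Hm KtE HtK KQE AP.
split.
  split; first exact: (transform_linear_op Hm KtE HtK KQE).
    by move=> f Hf; have [] := transform_hmem_le Hm KtE HtK KQE Hf.
  by move=> g Htg; have [HAg Ag _ _] := AP g Htg; exists (A g).
exists A; split; first exact: (lift_adjoint Hm KtE HtK KQE AP).
split.
  split; first exact: (lift_linear_op Hm KQE AP).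
  by move=> g Htg; have [] := AP g Htg.
split.
  split=> [x|B linB bndB BP g Htg]; first by rewrite Ak.
  apply: (bounded_op_unique Hm KtE HtK KQE AP linB bndB) => // x.
  exact: (generator_integral_unique hH hint (BP x)).
move=> HQ N; split; first by move=> g Htg; have [] := AP g Htg.
split.
  split; first exact: (lift_range_orthocompl Hm KtE HtK KQE AP).
  exact: (orthocompl_lift_range Hm KtE HtK KQE AP).
split=> [f Hf|g Htg]; first exact: (lift_decomposition Hm KtE HtK KQE AP Hf).
split; first exact: (lift_fiber Hm KtE HtK KQE AP Htg).
split; first by have [] := AP g Htg.
exact: (lift_min_norm Hm KtE HtK KQE AP Htg).
Qed.
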